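(* Let $G\in\mathbb{R}^{n\times n}$ be the pseudogradient matrix of the $N$-player linear-quadratic game described in the context, with shared constraints $Ax\le b$, $Ex=f$, where $A\in\mathbb{R}^{m\times n}$ and $E\in\mathbb{R}^{q\times n}$, and assume that the symmetric part $G_s=\tfrac12(G+G^\top)$ is positive definite. Let $W\subseteq\{1,\dots,m\}$, let $A_W$ be the rows of $A$ indexed by $W$, and let $\bar A_W=\begin{bmatrix}A_W\\ E\end{bmatrix}$ have full row rank. Let $p\in\{1,\dots,m\}\setminus W$, let $a_p^\top$ denote the $p$-th row of $A$, and assume $a_p\neq 0$. Let $z\in\mathbb{R}^n$ be the primal step direction $$z=G^{-1}\bigl(\bar A_W^\top\bar r_W-a_p\bigr),\qquad \bar r_W=\bigl(\bar A_W G^{-1}\bar A_W^\top\bigr)^{-1}\bar A_W G^{-1}a_p,$$ which satisfies $\bar A_W z=0$. Then the following are equivalent: (i) $a_p\notin\operatorname{rowspan}(\bar A_W)$; (ii) $z\neq 0$; (iii) $a_p^\top z<0$.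
   Context: Consider an $N$-player game in which player $i\in\{1,\dots,N\}$ has decision vector $x_i\in\mathbb{R}^{n_i}$, with $x=(x_1,\dots,x_N)\in\mathbb{R}^n$ and $n=\sum_{i=1}^N n_i$. Player $i$ minimizes over $x_i$ the cost $\tfrac12 x^\top Q^{(i)}x+(c^{(i)})^\top x$ subject to shared constraints $Ax\le b$, $Ex=f$, with $A\in\mathbb{R}^{m\times n}$, $b\in\mathbb{R}^m$, $E\in\mathbb{R}^{q\times n}$, $f\in\mathbb{R}^q$ ($m,q\ge 0$), where $Q^{(i)}\in\mathbb{R}^{n\times n}$ is symmetric, $c^{(i)}\in\mathbb{R}^n$, and the $i$-th diagonal block $Q^{(i)}_{ii}\in\mathbb{R}^{n_i\times n_i}$ is positive definite. The pseudogradient matrix $G\in\mathbb{R}^{n\times n}$ is obtained by stacking block rows: the $i$-th block row of $G$ (the $n_i$ rows corresponding to $x_i$) equals the $i$-th block row of $Q^{(i)}$, i.e. $G_{i,:}=Q^{(i)}_{i,:}$ for $i=1,\dots,N$. In general $G$ is not symmetric. When $G_s$ is positive definite and $\bar A_W$ has full row rank, both $G$ and $\bar A_W G^{-1}\bar A_W^\top$ are invertible, so $z$ and $\bar r_W$ are well defined. Here $\operatorname{rowspan}(\bar A_W)=\{\bar A_W^\top v: v\in\mathbb{R}^{|W|+q}\}\subseteq\mathbb{R}^n$. *)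

(* Defs.v *)
From mathcomp Require Import all_boot all_order all_algebra.
From mathcomp Require Import reals.

Set Implicit Arguments.
Unset Strict Implicit.
Unset Printing Implicit Defensive.

Import Order.TTheory GRing.Theory Num.Theory.
Local Open Scope ring_scope.

(* Symmetry of M is not included; the quadratic form only sees the symmetric
   part of M. *)
Definition posdefmx (R : realType) (n : nat) (M : 'M[R]_n) : Prop :=
  forall x : 'cV[R]_n, x != 0 -> 0 < (x^T *m M *m x) 0 0.

Definition sym_part (R : realType) (n : nat) (M : 'M[R]_n) : 'M[R]_n :=
  2^-1 *: (M + M^T).

(* a lies in {M^T v : v}, the row vectors of M being read as columns. *)
Definition in_rowspan (R : realType) (k n : nat) (M : 'M[R]_(k, n))
    (a : 'cV[R]_n) : Prop :=
  exists v : 'cV[R]_k, a = M^T *m v.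

(* Linear-quadratic game: player i controls the i-th block, of size d i, of
   x : 'cV_(\sum_i d i), and minimizes [lq_cost g i] over that block subject to
   [lq_feasible g]. *)
Record lq_game (R : realType) (N : nat) (d : 'I_N -> nat) (m q : nat) :=
  LQGame {
    lq_Q : 'I_N -> 'M[R]_(\sum_(i < N) d i);
    lq_c : 'I_N -> 'cV[R]_(\sum_(i < N) d i);
    lq_A : 'M[R]_(m, \sum_(i < N) d i);
    lq_b : 'cV[R]_m;
    lq_E : 'M[R]_(q, \sum_(i < N) d i);
    lq_f : 'cV[R]_q;
    lq_Q_sym : forall i, (lq_Q i)^T = lq_Q i;
    lq_Q_posdef : forall i, posdefmx (submxblock (lq_Q i) i i)
  }.

Definition lq_cost (R : realType) (N : nat) (d : 'I_N -> nat) (m q : nat)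
    (g : lq_game R d m q) (i : 'I_N) (x : 'cV[R]_(\sum_(i < N) d i)) : R :=
  2^-1 * (x^T *m lq_Q g i *m x) 0 0 + ((lq_c g i)^T *m x) 0 0.

Definition lq_feasible (R : realType) (N : nat) (d : 'I_N -> nat) (m q : nat)
    (g : lq_game R d m q) (x : 'cV[R]_(\sum_(i < N) d i)) : Prop :=
  (forall k, (lq_A g *m x) k 0 <= lq_b g k 0) /\ lq_E g *m x = lq_f g.

Definition pseudogradient (R : realType) (N : nat) (d : 'I_N -> nat)
    (m q : nat) (g : lq_game R d m q) : 'M[R]_(\sum_(i < N) d i) :=
  \mxcol_(i < N) submxcol (lq_Q g i) i.

(* The rows of A indexed by W, in increasing order, stacked on top of E. *)
Definition active_mx (R : realType) (N : nat) (d : 'I_N -> nat) (m q : nat)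
    (g : lq_game R d m q) (W : {set 'I_m}) :
    'M[R]_(#|W| + q, \sum_(i < N) d i) :=
  col_mx (rowsub (fun k : 'I_#|W| => enum_val k) (lq_A g)) (lq_E g).

(* [invmx] returns its argument on singular matrices.  If sym_part G is
   positive definite and B is row free, then G and B *m invmx G *m B^T are
   both invertible. *)
Definition step_multiplier (R : realType) (k n : nat) (G : 'M[R]_n)
    (B : 'M[R]_(k, n)) (a : 'cV[R]_n) : 'cV[R]_k :=
  invmx (B *m invmx G *m B^T) *m B *m invmx G *m a.

Definition step_direction (R : realType) (k n : nat) (G : 'M[R]_n)
    (B : 'M[R]_(k, n)) (a : 'cV[R]_n) : 'cV[R]_n :=
  invmx G *m (B^T *m step_multiplier G B a - a).

(* Main.v *)
Require Import Defs.
From mathcomp Require Import all_boot all_order all_algebra.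
From mathcomp Require Import reals.

Import Order.TTheory GRing.Theory Num.Theory.
Local Open Scope ring_scope.

(** Write G for the pseudogradient, B for the active matrix, a for the new
    constraint normal, r for the multiplier and z for the step.  The quadratic
    form of G is that of its symmetric part, hence positive; so G is invertible
    ([posdefmx_unit]), and G^-1 and then the compression B G^-1 B^T to the
    independent rows of B inherit positivity ([posdefmx_inv],
    [posdefmx_compress]), so that r is well defined.
    The step is thus characterized by the two KKT identities G z = B^T r - a
    ([mulmx_step_direction]) and B z = 0 ([step_direction_ker]).  Pairing the
    first with z and using the second gives a^T z = - z^T G z
    ([step_direction_descent]), which is negative as soon as z is nonzero.
    If a^T z is negative then a cannot be some B^T v, for which
    a^T z = v^T B z = 0.  Finally z = 0 turns the first identity into
    a = B^T r, so a outside the row span forces z to be nonzero. *)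

Lemma quad_form_tr {R : realType} {n : nat} (M : 'M[R]_n) (x : 'cV[R]_n) :
  x^T *m M^T *m x = x^T *m M *m x.
Proof.
rewrite [RHS]mx11_scalar -tr_scalar_mx -mx11_scalar.
by rewrite !trmx_mul trmxK mulmxA.
Qed.

Lemma quad_form_sym_part {R : realType} {n : nat} (M : 'M[R]_n)
    (x : 'cV[R]_n) :
  x^T *m sym_part M *m x = x^T *m M *m x.
Proof.
rewrite /sym_part -scalemxAr -scalemxAl mulmxDr mulmxDl quad_form_tr.
by rewrite -mulr2n -scaler_nat scalerA mulVf ?scale1r ?pnatr_eq0.
Qed.

Lemma posdefmx_sym_part {R : realType} {n : nat} {M : 'M[R]_n} :
  posdefmx (sym_part M) -> posdefmx M.
Proof. by move=> Mpos x /Mpos; rewrite quad_form_sym_part. Qed.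

(** A kernel vector of M would make the quadratic form vanish. *)
Lemma posdefmx_unit {R : realType} {n : nat} {M : 'M[R]_n} :
  posdefmx M -> M \in unitmx.
Proof.
move=> Mpos; rewrite -row_free_unit; apply: inj_row_free => v vM0.
apply/eqP; apply: contraT => v_neq0.
have := Mpos v^T; rewrite trmx_eq0 => /(_ v_neq0).
by rewrite trmxK vM0 mul0mx mxE ltxx.
Qed.

(** The substitution x = M y turns the form of M^-1 at x into that of M^T,
    hence of M, at y. *)
Lemma posdefmx_inv {R : realType} {n : nat} {M : 'M[R]_n} :
  posdefmx M -> posdefmx (invmx M).
Proof.
move=> Mpos x x_neq0; have Munit := posdefmx_unit Mpos.
set y := invmx M *m x.
have xE : x = M *m y by rewrite mulKVmx.
have y_neq0 : y != 0.
  by apply: contraNneq x_neq0 => y0; rewrite xE y0 mulmx0.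
by rewrite -mulmxA -/y xE trmx_mul quad_form_tr Mpos.
Qed.

(** Independence of the rows of B says that w |-> B^T w is injective, so the
    form of M is only evaluated at nonzero vectors. *)
Lemma posdefmx_compress {R : realType} {k n : nat} {M : 'M[R]_n}
    {B : 'M[R]_(k, n)} :
  posdefmx M -> row_free B -> posdefmx (B *m M *m B^T).
Proof.
move=> Mpos Bfree w w_neq0.
have Bw_neq0 : B^T *m w != 0.
  by rewrite -trmx_eq0 trmx_mul trmxK mulmx_free_eq0 // trmx_eq0.
by have := Mpos _ Bw_neq0; rewrite trmx_mul trmxK !mulmxA.
Qed.

Lemma mulmx_step_direction {R : realType} {k n : nat} {G : 'M[R]_n}
    (B : 'M[R]_(k, n)) (a : 'cV[R]_n) :
  G \in unitmx ->
  G *m step_direction G B a = B^T *m step_multiplier G B a - a.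
Proof. by move=> Gunit; rewrite /step_direction mulKVmx. Qed.

(** The multiplier is the solution r of (B G^-1 B^T) r = B G^-1 a, which is
    the equation B z = 0 written out. *)
Lemma step_direction_ker {R : realType} {k n : nat} {G : 'M[R]_n}
    {B : 'M[R]_(k, n)} (a : 'cV[R]_n) :
  B *m invmx G *m B^T \in unitmx -> B *m step_direction G B a = 0.
Proof.
move=> Sunit; rewrite /step_direction /step_multiplier !mulmxBr !mulmxA.
by rewrite mulmxV // mul1mx subrr.
Qed.

(** Pair a = B^T r - G z with z: the term r^T B z vanishes. *)
Lemma step_direction_descent {R : realType} {k n : nat} {G : 'M[R]_n}
    {B : 'M[R]_(k, n)} (a : 'cV[R]_n) (z := step_direction G B a) :
  G \in unitmx -> B *m z = 0 -> a^T *m z = - (z^T *m G *m z).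
Proof.
move=> Gunit Bz0.
have aE : a = B^T *m step_multiplier G B a - G *m z.
  by rewrite mulmx_step_direction // subKr.
(* Products are matched up to unfolding: with z and r left transparent, the
   transposition below would also expand their definitions. *)
move: (step_multiplier G B a) aE => r aE; clearbody z.
rewrite [in LHS]aE linearB /= !trmx_mul trmxK mulmxBl -(mulmxA _ B) Bz0 mulmx0.
by rewrite sub0r quad_form_tr.
Qed.

Theorem lemma4p2 (R : realType) (N : nat) (d : 'I_N -> nat) (m q : nat)
    (g : lq_game R d m q) (W : {set 'I_m}) (p : 'I_m)
    (G_posdef : posdefmx (sym_part (pseudogradient g)))
    (AW_free : row_free (active_mx g W))
    (pNW : p \notin W)
    (ap_neq0 : (row p (lq_A g))^T != 0) :
  let a := (row p (lq_A g))^T in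
  let z := step_direction (pseudogradient g) (active_mx g W) a in
  active_mx g W *m z = 0 /\
  [<-> ~ in_rowspan (active_mx g W) a;
       z <> 0;
       (a^T *m z) 0 0 < 0].
Proof.
move=> a z.
have Gpos := posdefmx_sym_part G_posdef.
have Gunit := posdefmx_unit Gpos.
have Bz0 : active_mx g W *m z = 0.
  apply/step_direction_ker/posdefmx_unit.
  exact: posdefmx_compress (posdefmx_inv Gpos) AW_free.
split=> //; tfae.
- move=> aNspan z0; apply: aNspan.
  exists (step_multiplier (pseudogradient g) (active_mx g W) a).
  apply/esym/eqP; rewrite -subr_eq0 -mulmx_step_direction //.
  by rewrite -/z z0 mulmx0.
- move=> /eqP z_neq0; rewrite step_direction_descent // mxE oppr_lt0.
  exact: Gpos.
- move=> az_lt0 [v aE]; move: az_lt0.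
  by rewrite aE trmx_mul trmxK -mulmxA Bz0 mulmx0 mxE ltxx.
Qed.
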